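(* Let $A,B,C$ be completely distributive lattices. For order-preserving maps $f\colon A\to B$ and $g\colon B\to C$ define $g\cdot f,\ g\bullet f\colon A\to C$ by $(g\cdot f)(a)=\bigvee\{c\in C\mid \exists b\in B:\ b\triangleleft f(a)\text{ and } c\triangleleft g(b)\}$ and $(g\bullet f)(a)=\bigwedge\{c\in C\mid \exists b\in B:\ b\triangleleft^{co} f(a)\text{ and } c\triangleleft^{co} g(b)\}$. (1) If $f\colon A\to B$ is meet-preserving and $g\colon B\to C$ is order-preserving, then $g\bullet f$ is meet-preserving. (2) If $f\colon A\to B$ and $g\colon B\to C$ are both meet-preserving, then $g\bullet f=g\circ f$, where $\circ$ is the usual composition. (3) If $f\colon A\to B$ and $g\colon B\to C$ are order-preserving, then $g\cdot f\leq g\bullet f$ pointwise. (4) If $f\colon A\to B$ and $g\colon B\to C$ are each both meet-preserving and sup-preserving, then $g\bullet f=g\cdot f$.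
   Context: In a complete lattice $P$, $x\triangleleft y$ (wedge-below) means that for every subset $S\subseteq P$ (possibly empty) with $y\leq\bigvee S$ there is $s\in S$ with $x\leq s$; $x\triangleleft^{co}y$ (co-wedge-below) means that for every subset $S\subseteq P$ (possibly empty) with $\bigwedge S\leq y$ there is $s\in S$ with $s\leq x$. A complete lattice $L$ is completely distributive if $x=\bigvee\{y\in L\mid y\triangleleft x\}$ for all $x\in L$. A map is sup-preserving (meet-preserving) if it preserves arbitrary suprema (infima), including the empty one. *)

(* Defs.v *)
From HB Require Import structures.
From mathcomp Require Import all_boot all_order.
From mathcomp Require Import boolp classical_sets.

Set Implicit Arguments.
Unset Strict Implicit.
Unset Printing Implicit Defensive.

Import Order.TTheory.

Local Open Scope classical_set_scope.
Local Open Scope order_scope.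

(* Suprema and infima of all subsets, including the empty one.  The finite
   operations and the bounds are not repeated as data, since they are
   determined by csup and cinf. *)
HB.mixin Record POrder_isCompleteLattice (d : Order.disp_t) T
    of Order.POrder d T := {
  csup : set T -> T;
  cinf : set T -> T;
  csupP : forall S : set T, supremums S (csup S);
  cinfP : forall S : set T, infimums S (cinf S)
}.

#[short(type="completeLatticeType")]
HB.structure Definition CompleteLattice (d : Order.disp_t) :=
  { T of Order.POrder d T & POrder_isCompleteLattice d T }.

Section CompleteLatticeDefs.
Context {d : Order.disp_t} {L : completeLatticeType d}.
Implicit Types (x y : L) (S : set L).

Definition wedge_below x y : Prop :=
  forall S, y <= csup S -> exists2 s, S s & x <= s.

(* The order is reversed: x lies above y when co_wedge_below x y. *)
Definition co_wedge_below x y : Prop :=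
  forall S, cinf S <= y -> exists2 s, S s & s <= x.

End CompleteLatticeDefs.

Definition completely_distributive (d : Order.disp_t)
    (L : completeLatticeType d) : Prop :=
  forall x : L, x = csup [set y | wedge_below y x].

Section Maps.
Context {dA dB : Order.disp_t}.
Context {A : completeLatticeType dA} {B : completeLatticeType dB}.

Definition order_preserving (f : A -> B) : Prop :=
  {homo f : x y / x <= y}.

Definition sup_preserving (f : A -> B) : Prop :=
  forall S : set A, f (csup S) = csup (f @` S).

Definition meet_preserving (f : A -> B) : Prop :=
  forall S : set A, f (cinf S) = cinf (f @` S).

End Maps.

Section Compositions.
Context {dA dB dC : Order.disp_t}.
Context {A : completeLatticeType dA} {B : completeLatticeType dB}.
Context {C : completeLatticeType dC}.

Definition dot_comp (g : B -> C) (f : A -> B) (a : A) : C :=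
  csup [set c | exists b, wedge_below b (f a) /\ wedge_below c (g b)].

Definition bullet_comp (g : B -> C) (f : A -> B) (a : A) : C :=
  cinf [set c | exists b, co_wedge_below b (f a) /\ co_wedge_below c (g b)].

End Compositions.

(* Main.v *)
(* Complete distributivity is self-dual.  Let [u] be the infimum of the elements
   co-wedge-below [x], and for each [z] let [y] be the supremum of the elements
   not above [z].  If [z] is not below [x], then [y] is co-wedge-below [x], so
   [u <= y]; if [z] is wedge-below [u], this is impossible.  Hence [u = x].
   Applying this formula twice makes the co-wedge-below relation interpolative,
   which gives (1).  By the same formula, the bullet composition at [a] is the
   infimum of the [g b] with [b] co-wedge-below [f a], which gives (2).  For (3)
   and (4), the usual composition lies between the two others, and equals the
   upper (lower) one when [g] preserves infima (suprema). *)

Require Import Defs.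
From HB Require Import structures.
From mathcomp Require Import all_boot all_order.
From mathcomp Require Import boolp classical_sets.

Set Implicit Arguments.
Unset Strict Implicit.
Unset Printing Implicit Defensive.

Import Order.TTheory.

Local Open Scope order_scope.
Local Open Scope classical_set_scope.

Section CompleteLatticeTheory.
Context {d : Order.disp_t} {L : completeLatticeType d}.
Implicit Types (x y z : L) (S : set L).

Lemma csup_ub S x : S x -> x <= csup S.
Proof. by case: (csupP S) => ub _; exact: ub. Qed.

Lemma csup_le S y : (forall x, S x -> x <= y) -> csup S <= y.
Proof. by case: (csupP S) => _ lub Sy; exact: lub. Qed.

Lemma cinf_lb S x : S x -> cinf S <= x.
Proof. by case: (cinfP S) => lb _; exact: lb. Qed.

Lemma cinf_ge S y : (forall x, S x -> y <= x) -> y <= cinf S.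
Proof. by case: (cinfP S) => _ glb Sy; exact: glb. Qed.

Lemma wedge_below_le x y : wedge_below x y -> x <= y.
Proof. by move=> /(_ [set y]) [|_ -> //]; exact: csup_ub. Qed.

Lemma co_wedge_below_ge x y : co_wedge_below x y -> y <= x.
Proof. by move=> /(_ [set y]) [|_ -> //]; exact: cinf_lb. Qed.

Lemma co_wedge_below_trans x y z :
  co_wedge_below x y -> z <= y -> co_wedge_below x z.
Proof. by move=> xy zy S Sz; apply: xy; exact: le_trans zy. Qed.

Hypothesis L_cd : completely_distributive L.

Lemma wedge_below_approx x y : (forall z, wedge_below z x -> z <= y) -> x <= y.
Proof. by move=> h; rewrite (L_cd x); exact: csup_le. Qed.

Lemma co_wedge_below_cinf x : cinf [set y | co_wedge_below y x] = x.
Proof.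
apply/le_anti/andP; split; last by apply: cinf_ge => y /co_wedge_below_ge.
set u := cinf _; apply: wedge_below_approx => z zu.
apply: contrapT => zx.
pose y := csup [set t | ~ z <= t].
have yx : co_wedge_below y x.
  (* If no member of [S] lay below [y], every member would be above [z], since any other is among
     the elements whose supremum is [y]. Then [z <= cinf S <= x]. *)
  move=> S Sx; apply: contrapT => noS; apply: zx; apply: le_trans Sx.
  apply: cinf_ge => s Ss; apply: contrapT => zs.
  by apply: noS; exists s => //; exact: csup_ub.
have uy : u <= y by exact: cinf_lb.
(* Wedge-belowness of [z] yields some [t] above [z] in the very set of elements not above [z]. *)
by have [] := zu _ uy.
Qed.

Lemma co_wedge_below_approx x y :
  (forall z, co_wedge_below z x -> y <= z) -> y <= x.
Proof. by move=> h; rewrite -(co_wedge_below_cinf x); exact: cinf_ge. Qed.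

(** The elements reachable from [y] in two co-wedge-below steps have infimum at most [y], so one of
    them lies below [x]; its intermediate element interpolates. *)
Lemma co_wedge_below_interpolation x y : co_wedge_below x y ->
  exists2 z, co_wedge_below x z & co_wedge_below z y.
Proof.
pose S := [set t | exists2 z, co_wedge_below t z & co_wedge_below z y].
have Sy : cinf S <= y.
  apply: co_wedge_below_approx => z zy; apply: co_wedge_below_approx => t tz.
  by apply: cinf_lb; exists z.
(* Being co-wedge-below [z] passes from [t] to the larger [x]. *)
move=> /(_ S Sy) [t [z tz zy] tx]; exists z => // S' /tz [s S's st].
by exists s => //; exact: le_trans tx.
Qed.

End CompleteLatticeTheory.

Lemma meet_preserving_homo (dA dB : Order.disp_t) (A : completeLatticeType dA)
    (B : completeLatticeType dB) (f : A -> B) :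
  meet_preserving f -> order_preserving f.
Proof.
move=> f_meet x y xy.
have -> : x = cinf [set x; y].
  apply/le_anti/andP; split; last by apply: cinf_lb; left.
  by apply: cinf_ge => _ [->|->].
by rewrite f_meet; apply: cinf_lb; exists y => //; right.
Qed.

Section Compositions.
Context {dA dB dC : Order.disp_t}.
Context {A : completeLatticeType dA} {B : completeLatticeType dB}.
Context {C : completeLatticeType dC}.
Implicit Types (f : A -> B) (g : B -> C).

Lemma bullet_comp_homo f g : order_preserving f ->
  order_preserving (bullet_comp g f).
Proof.
move=> f_homo x y xy; apply: cinf_ge => c [b [bfy cgb]]; apply: cinf_lb.
by exists b; split=> //; apply: co_wedge_below_trans bfy _; exact: f_homo.
Qed.

Lemma comp_le_bullet f g : order_preserving g ->
  forall a, g (f a) <= bullet_comp g f a.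
Proof.
move=> g_homo a; apply: cinf_ge => c [b [bfa cgb]].
apply: le_trans (co_wedge_below_ge cgb).
by apply: g_homo; exact: co_wedge_below_ge.
Qed.

Lemma dot_le_comp f g : order_preserving g ->
  forall a, dot_comp g f a <= g (f a).
Proof.
move=> g_homo a; apply: csup_le => c [b [bfa cgb]].
apply: le_trans (wedge_below_le cgb) _.
by apply: g_homo; exact: wedge_below_le.
Qed.

(** One inequality is monotonicity. For the other, each [c] in the set defining the left side must
    be shown to occur in the set for a single [s] in [S]. *)
Lemma bullet_comp_meet_preserving f g : completely_distributive B ->
  meet_preserving f -> meet_preserving (bullet_comp g f).
Proof.
move=> hB f_meet S; apply/le_anti/andP; split.
  apply: cinf_ge => _ [s Ss <-].
  apply: bullet_comp_homo; first exact: meet_preserving_homo.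
  exact: cinf_lb.
apply: cinf_ge => c [b [bfS cgb]].
have [b' bb' b'fS] := co_wedge_below_interpolation hB bfS.
(* The interpolant [b'] is spent on selecting [s] with [f s <= b']; the remaining relation between
   [b] and [b'] then descends to [f s]. *)
rewrite f_meet in b'fS; have [_ [s Ss <-] fsb'] := b'fS _ (lexx _).
apply: (@le_trans _ _ (bullet_comp g f s)); first by apply: cinf_lb; exists s.
by apply: cinf_lb; exists b; split=> //; exact: co_wedge_below_trans fsb'.
Qed.

Lemma bullet_compE f g :
  completely_distributive B -> completely_distributive C ->
  meet_preserving g -> bullet_comp g f = g \o f.
Proof.
move=> hB hC g_meet; apply/funext => a; apply/le_anti/andP; split; last first.
  by apply: comp_le_bullet; exact: meet_preserving_homo.
(* Writing [f a] as an infimum turns [g (f a)] into the infimum of the [g b], each of which is in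
   turn approximated from above in [C]. *)
rewrite /= -[f a in leRHS](co_wedge_below_cinf hB) g_meet.
apply: cinf_ge => _ [b bfa <-]; apply: (co_wedge_below_approx hC) => c cgb.
by apply: cinf_lb; exists b.
Qed.

(** Order dual of [bullet_compE], with complete distributivity itself as the approximation
    formula. *)
Lemma dot_compE f g :
  completely_distributive B -> completely_distributive C ->
  order_preserving g -> sup_preserving g -> dot_comp g f = g \o f.
Proof.
move=> hB hC g_homo g_sup; apply/funext => a; apply/le_anti/andP; split.
  exact: dot_le_comp.
rewrite /= [f a in leLHS]hB g_sup.
apply: csup_le => _ [b bfa <-]; apply: (wedge_below_approx hC) => c cgb.
by apply: csup_ub; exists b.
Qed.

End Compositions.

Local Close Scope classical_set_scope.

Theorem proposition4p6 (dA dB dC : Order.disp_t)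
    (A : completeLatticeType dA) (B : completeLatticeType dB)
    (C : completeLatticeType dC)
    (hA : completely_distributive A) (hB : completely_distributive B)
    (hC : completely_distributive C) :
  [/\ forall (f : A -> B) (g : B -> C),
        meet_preserving f -> order_preserving g ->
        meet_preserving (bullet_comp g f),
      forall (f : A -> B) (g : B -> C),
        meet_preserving f -> meet_preserving g ->
        bullet_comp g f = g \o f,
      forall (f : A -> B) (g : B -> C),
        order_preserving f -> order_preserving g ->
        forall a : A, dot_comp g f a <= bullet_comp g f a
    & forall (f : A -> B) (g : B -> C),
        meet_preserving f -> sup_preserving f ->
        meet_preserving g -> sup_preserving g ->
        bullet_comp g f = dot_comp g f].
Proof.
split=> f g.
- by move=> f_meet _; exact: bullet_comp_meet_preserving.
- by move=> _ g_meet; exact: bullet_compE.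
- move=> _ g_homo a; apply: (@le_trans _ _ (g (f a))).
    exact: dot_le_comp.
  exact: comp_le_bullet.
- move=> _ _ g_meet g_sup; rewrite bullet_compE // dot_compE //.
  exact: meet_preserving_homo.
Qed.
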